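(* Let $r\ge 2$ be an integer, let $w(x)=x^\alpha(1-x)^\beta$ with $\alpha,\beta>0$, and let $B^\ast_{n,r-1}$ be the modified combination of Bernstein operators described in the context. Then there is a constant $C>0$, independent of $n$, $x$ and $f$, such that for every $f\in C_w$, $$\|w\,(B^{\ast}_{n,r-1}(f))^{(r)}\|\leqslant C\,n^{r}\,\|wf\|.$$
   Context: $w(x)=x^\alpha(1-x)^\beta$ on $[0,1]$. $C_w=\{f\in C((0,1)):\lim_{x\to0}(wf)(x)=\lim_{x\to1}(wf)(x)=0\}$, with $\|wf\|=\sup_{0\le x\le1}|w(x)f(x)|$. Bernstein operators: $B_m(g,x)=\sum_{k=0}^m g(k/m)p_{m,k}(x)$, $p_{m,k}(x)=\binom{m}{k}x^k(1-x)^{m-k}$. Combination: $B_{n,r-1}(g,x)=\sum_{i=0}^{r-2}C_i(n)B_{n_i}(g,x)$, where (a) $n=n_0<n_1<\dots<n_{r-2}\le Cn$, (b) $\sum_i|C_i(n)|\le C$, (c) $\sum_i C_i(n)=1$, (d) $\sum_i C_i(n)n_i^{-k}=0$ for $k=1,\dots,r-2$. Modified operator: $B^\ast_{n,r-1}(f,x)=B_{n,r-1}(F_n,x)$, where $F_n$ is obtained from $f$ by replacing it near the endpoints by interpolation polynomials: let $L_r(f,x)$ be the Lagrange interpolation polynomial of $f$ at the nodes $i/n$, $i=1,\dots,r$, and $R_r(f,x)$ the one at the nodes $1-i/n$, $i=1,\dots,r$; let $\psi\in C^\infty(\mathbb R)$ with $0\le\psi\le1$, $\psi(t)=0$ for $t\le0$,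 $\psi(t)=1$ for $t\ge1$. Then $F_n=f$ on $[2/n,1-2/n]$, $F_n=L_r(f,\cdot)$ on $[0,1/n]$, $F_n(x)=L_r(f,x)+\psi(nx-1)(f(x)-L_r(f,x))$ on $[1/n,2/n]$, and symmetrically $F_n=R_r(f,\cdot)$ on $[1-1/n,1]$, $F_n(x)=R_r(f,x)+\psi(n-nx-1)(f(x)-R_r(f,x))$ on $[1-2/n,1-1/n]$. *)

(* Defs.v *)
From HB Require Import structures.
From mathcomp Require Import all_boot all_order all_algebra.
From mathcomp Require Import all_classical all_reals all_analysis.
Set Implicit Arguments. Unset Strict Implicit. Unset Printing Implicit Defensive.
Import Order.TTheory GRing.Theory Num.Theory.
Import numFieldNormedType.Exports.
Local Open Scope classical_set_scope.
Local Open Scope ring_scope.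

Section Defs.
Variable R : realType.

Definition jweight (alpha beta : R) (x : R) : R := x `^ alpha * (1 - x) `^ beta.

Definition in_Cw (alpha beta : R) (f : R -> R) : Prop :=
  {in `]0, 1[, continuous f} /\
  (fun x => jweight alpha beta x * f x) @ at_right 0 --> 0 /\
  (fun x => jweight alpha beta x * f x) @ at_left 1 --> 0.

Definition smooth (psi : R -> R) : Prop :=
  forall (k : nat) (x : R), derivable (derive1n k psi) x 1.

Definition lagrange (f : R -> R) (pts : nat -> R) (r : nat) (x : R) : R :=
  \sum_(1 <= i < r.+1) f (pts i) *
    \prod_(1 <= j < r.+1 | j != i) ((x - pts j) / (pts i - pts j)).

Definition Lint (r n : nat) (f : R -> R) (x : R) : R :=
  lagrange f (fun i => i%:R / n%:R) r x.
Definition Rint (r n : nat) (f : R -> R) (x : R) : R :=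
  lagrange f (fun i => 1 - i%:R / n%:R) r x.

Definition Fmod (psi : R -> R) (r n : nat) (f : R -> R) (x : R) : R :=
  if x <= 1 / n%:R then Lint r n f x
  else if x <= 2 / n%:R then
    Lint r n f x + psi (n%:R * x - 1) * (f x - Lint r n f x)
  else if x < 1 - 2 / n%:R then f x
  else if x < 1 - 1 / n%:R then
    Rint r n f x + psi (n%:R - n%:R * x - 1) * (f x - Rint r n f x)
  else Rint r n f x.

Definition bernstein (g : R -> R) (m : nat) : {poly R} :=
  \sum_(k < m.+1) (g (k%:R / m%:R) * 'C(m, k)%:R) *: ('X ^+ k * (1 - 'X) ^+ (m - k)).

Definition bcomb (nn : nat -> nat -> nat) (c : nat -> nat -> R) (r n : nat)
  (g : R -> R) : {poly R} :=
  \sum_(i < r.-1) c n i *: bernstein g (nn n i).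

Definition bstar (psi : R -> R) (nn : nat -> nat -> nat) (c : nat -> nat -> R)
  (r n : nat) (f : R -> R) : {poly R} :=
  bcomb nn c r n (Fmod psi r n f).

Definition admissible_comb (nn : nat -> nat -> nat) (c : nat -> nat -> R)
  (r : nat) (K : R) : Prop :=
  forall n : nat, (0 < n)%N ->
    [/\ nn n 0%N = n,
        (forall i : nat, (i.+1 < r.-1)%N -> (nn n i < nn n i.+1)%N),
        (nn n (r - 2)%N)%:R <= K * n%:R /\
        \sum_(i < r.-1) `|c n i| <= K,
        \sum_(i < r.-1) c n i = 1 &
        (forall k : nat, (1 <= k <= r - 2)%N ->
           \sum_(i < r.-1) c n i * ((nn n i)%:R ^+ k)^-1 = 0)].

End Defs.

(* Main.v *)
Require Import Defs.
From HB Require Import structures.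
From mathcomp Require Import all_boot all_order all_algebra.
From mathcomp Require Import all_classical all_reals all_analysis.
From mathcomp Require Import ring lra zify.
Import Order.TTheory GRing.Theory Num.Theory.
Import numFieldNormedType.Exports.
Local Open Scope ring_scope.
Set Implicit Arguments. Unset Strict Implicit. Unset Printing Implicit Defensive.

(** The [r]-th derivative of a Bernstein polynomial of degree [m = N + r] is
    [m (m - 1) ... (m - r + 1)], which is [O(n^r)], times the Bernstein polynomial
    of degree [N] of the [r]-th forward differences of the nodal values.
    Interpolating near the endpoints bounds [F_n y] by a constant times
    [||wf|| U^-alpha V^-beta], where [U = max(y, 1/n)] and [V = max(1 - y, 1/n)].
    It remains to bound
    [sum_k ((N+1) x/(k+1))^a ((N+1) (1-x)/(N-k+1))^b p_{N,k}(x)]; for natural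
    numbers [a, b] each summand is at most [a! b! p_{N+a+b,k+a}(x)], so the sum is
    at most [a! b!], and real exponents reduce to natural ones by
    [s^alpha <= 1 + s^a] for [alpha <= a]. *)

(** * Derivatives of Bernstein polynomials *)

(** The nodal values form an arbitrary sequence, so that differentiation stays within the class: the
    degree drops while the node spacing remains that of the original polynomial. *)
Definition bernpoly (R : realType) (a : nat -> R) (m : nat) : {poly R} :=
  \sum_(k < m.+1) (a k * 'C(m, k)%:R) *: ('X ^+ k * (1 - 'X) ^+ (m - k)).

Definition fdiff (R : realType) (a : nat -> R) (k : nat) : R := a k.+1 - a k.

Lemma deriv_bernpoly (R : realType) (a : nat -> R) (m : nat) :
  (bernpoly a m.+1)^`() = m.+1%:R *: bernpoly (fdiff a) m.
Proof.
have dterm k : ('X ^+ k * (1 - 'X) ^+ (m.+1 - k))^`() =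
    k%:R *: ('X ^+ k.-1 * (1 - 'X) ^+ (m.+1 - k))
    - (m.+1 - k)%:R *: ('X ^+ k * (1 - 'X) ^+ (m - k)) :> {poly R}.
  rewrite derivM derivXn deriv_exp derivB derivX -polyC1 derivC sub0r.
  rewrite polyC1 mulNr mul1r mulNrn mulrN subSKn.
  by rewrite mulrnAl mulrnAr !scaler_nat.
rewrite /bernpoly raddf_sum /=.
under eq_bigr => k _ do rewrite derivZ dterm scalerBr !scalerA.
(* The terms that vanish, [k = 0] in the first sum and [k = m.+1] in the second, are those where
   [k.-1] and [m - k] truncate. Shifting the first sum then aligns the powers. *)
rewrite sumrB big_ord_recl /= mulr0 scale0r add0r.
rewrite [X in _ - X]big_ord_recr /= subnn mulr0 scale0r addr0.
rewrite -sumrB scaler_sumr; apply: eq_bigr => k _.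
rewrite /bump /= add1n subSS subSn; last by rewrite -ltnS.
rewrite scalerA -scalerBl; congr (_ *: _).
have e1 : 'C(m.+1, k.+1)%:R * k.+1%:R = m.+1%:R * 'C(m, k)%:R :> R.
  by rewrite -!natrM mulnC -mul_bin_diag.
have e2 : 'C(m.+1, k)%:R * (m - k).+1%:R = m.+1%:R * 'C(m, k)%:R :> R.
  rewrite -!natrM mulnC -subSn; last by rewrite -ltnS.
  by rewrite -mul_bin_down.
by rewrite -!mulrA e1 e2 /fdiff; ring.
Qed.

Lemma derivn_bernpoly (R : realType) (a : nat -> R) (N r : nat) :
  (bernpoly a (N + r))^`(r) =
  ((N + r) ^_ r)%:R *: bernpoly (iter r (@fdiff R) a) N.
Proof.
elim: r a => [|r IH] a; first by rewrite addn0 ffactn0 derivn0 scale1r.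
rewrite derivSn addnS deriv_bernpoly derivnZ IH scalerA -natrM.
by rewrite ffactSS -iterSr.
Qed.

(** Each difference at most doubles the bound. The weight [w] belongs to the evaluation point, so it
    is the same for all the nodes involved. *)
Lemma fdiff_iter_le (R : realType) (a : nat -> R) (r k : nat) (w B : R) :
  0 <= w -> (forall j, (j <= r)%N -> w * `|a (k + j)%N| <= B) ->
  w * `|iter r (@fdiff R) a k| <= 2 ^+ r * B.
Proof.
move=> w0; elim: r k => [|r IH] k aB.
  by rewrite mul1r -{1}[k]addn0 aB.
rewrite iterS /fdiff -/(@fdiff R) exprS -mulrA mulr_natl mulr2n.
rewrite (le_trans (ler_wpM2l w0 (ler_normB _ _)))// mulrDr lerD//.
  by apply: IH => j jr; rewrite addSnnS aB.
by apply: IH => j jr; rewrite aB// ltnW.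
Qed.

(** * Weighted Bernstein sums and powers *)

(** Each induction step absorbs one factor [N.+1 <= (N + a).+1] into the binomial by [mul_bin_diag],
    at the cost of [(k + a).+1 <= a.+1 * k.+1]. *)
Lemma expn_bin_le (N k a : nat) :
  (N.+1 ^ a * 'C(N, k) <= a`! * k.+1 ^ a * 'C(N + a, k + a))%N.
Proof.
elim: a => [|a IH]; first by rewrite !expn0 !mul1n !addn0.
rewrite expnS -mulnA (leq_trans (leq_mul (leqnn _) IH))//.
rewrite (@leq_trans (a`! * k.+1 ^ a * ((N + a).+1 * 'C(N + a, k + a))))//.
  by rewrite mulnCA leq_mul// leq_mul// ltnS leq_addr.
rewrite mul_bin_diag mulnA !addnS leq_mul// factS expnS.
rewrite mulnACA mulnC leq_mul//.
by clear; nia.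
Qed.

(** Two uses of [expn_bin_le]: the second, after the symmetry of binomial coefficients, raises the
    complementary index [N - k] by [b]. *)
Lemma expn_bin_le2 (N k a b : nat) : (k <= N)%N ->
  (N.+1 ^ a * N.+1 ^ b * 'C(N, k) <=
   a`! * b`! * (k.+1 ^ a * (N - k).+1 ^ b) * 'C(N + a + b, k + a))%N.
Proof.
move=> kN; have h1 := expn_bin_le N k a.
have h2 := expn_bin_le (N + a) (N - k) b.
have eC : 'C(N + a, k + a) = 'C(N + a, N - k).
  by rewrite -bin_sub ?leq_add2r// subnDr.
have eC' : 'C(N + a + b, k + a) = 'C(N + a + b, N - k + b).
  rewrite -bin_sub; last by rewrite -addnA leq_add// leq_addr.
  by congr 'C(_, _); lia.
rewrite mulnAC (leq_trans (leq_mul h1 (leqnn _)))// eC -mulnA.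
rewrite (@leq_trans (a`! * k.+1 ^ a *
    ((N + a).+1 ^ b * 'C(N + a, N - k))))//.
  rewrite leq_mul// mulnC leq_mul//; case: (b) => // b'.
  by rewrite leq_exp2r// ltnS leq_addr.
by rewrite (leq_trans (leq_mul (leqnn _) h2))// eC' !mulnA; apply: eq_leq; lia.
Qed.

Lemma bernstein_sum_le (R : realType) (N a b : nat) (x : R) : 0 <= x <= 1 ->
  \sum_(k < N.+1) (N.+1%:R * x / k.+1%:R) ^+ a *
     (N.+1%:R * (1 - x) / (N - k).+1%:R) ^+ b *
     ('C(N, k)%:R * (x ^+ k * (1 - x) ^+ (N - k))) <= (a`! * b`!)%:R.
Proof.
move=> /andP[x0 x1]; have y0 : 0 <= 1 - x by rewrite subr_ge0.
pose p k := 'C(N + a + b, k)%:R * (x ^+ k * (1 - x) ^+ (N + a + b - k)).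
have p0 k : 0 <= p k by rewrite !mulr_ge0// exprn_ge0.
have sp : \sum_(0 <= k < (N + a + b).+1) p k = 1.
  rewrite big_mkord -[RHS](expr1n _ (N + a + b)) -[X in _ = X ^+ _](subrK x).
  rewrite exprDn; apply: eq_bigr => k _.
  by rewrite /p [_ * _ ^+ (_ - _)]mulrC mulr_natl.
have -> : (a`! * b`!)%:R = (a`! * b`!)%:R * 1 :> R by rewrite mulr1.
have sh : \sum_(0 <= k < N.+1) p (k + a)%N = \sum_(a <= k < N.+1 + a) p k.
  by have := @big_addn _ 0 +%R 0 (N.+1 + a) a xpredT p; rewrite add0n addnK => ->.
apply: (@le_trans _ _ ((a`! * b`!)%:R * \sum_(k < N.+1) p (k + a)%N)); last first.
  (* The shifted sum is a block of the binomial expansion of [(x + (1 - x)) ^+ (N + a + b) = 1]; the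
     terms on either side of it are nonnegative. *)
  rewrite ler_wpM2l// -sp (@big_cat_nat _ _ _ a)//=; last by lia.
  rewrite [X in _ + X](@big_cat_nat _ _ _ (N.+1 + a))//=; try lia.
  rewrite -(big_mkord xpredT (fun k => p (k + a)%N)).
  rewrite -sh addrCA lerDl addr_ge0//; apply: sumr_ge0 => //.
rewrite mulr_sumr; apply: ler_sum => k _.
have kN : (k <= N)%N by rewrite -ltnS.
rewrite /p (_ : N + a + b - (k + a) = N - k + b)%N; last by lia.
rewrite !exprMn !exprD !exprVn.
(* The regrouping isolates the powers of [x] and [1 - x], identical on both sides; what remains is
   an inequality between natural numbers. *)
have -> : forall A B C D E F G H I : R, A * B * C * (D * E * F) * (G * (H * I)) =
   (A * D * G * (C * F)) * ((H * B) * (I * E)) by move=> *; ring.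
rewrite [leRHS]mulrA ler_wpM2r//; first by rewrite !mulr_ge0 ?exprn_ge0.
rewrite -invfM ler_pdivrMr ?mulr_gt0 ?exprn_gt0//.
rewrite -!natrX -!natrM ler_nat.
by rewrite (leq_trans (expn_bin_le2 a b kN))//; apply: eq_leq; lia.
Qed.

Lemma powR_le1DX (R : realType) (s alpha : R) (a : nat) :
  0 <= s -> 0 <= alpha <= a%:R -> s `^ alpha <= 1 + s ^+ a.
Proof.
move=> s0 /andP[al0 ala]; have [s1|s1] := leP s 1.
  by rewrite (le_trans (ge0_ler_powR al0 _ _ s1)) ?nnegrE// powR1 lerDl exprn_ge0.
by rewrite -powR_mulrn// (le_trans (ler_powR (ltW s1) ala))// lerDr.
Qed.

(** * Interpolation near the endpoints *)

(** Each basis factor is at most [(r h) / h = r]; the omitted index counts as a factor [1 <= r],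
    which gives the power [r ^ r]. *)
Lemma lagrange_le (R : realType) (f : R -> R) (pts : nat -> R) (r : nat)
    (h B y : R) : (0 < r)%N -> 0 < h ->
  (forall j, (1 <= j <= r)%N -> `|y - pts j| <= r%:R * h) ->
  (forall i j, (1 <= i <= r)%N -> (1 <= j <= r)%N -> j != i ->
     h <= `|pts i - pts j|) ->
  (forall i, (1 <= i <= r)%N -> `|f (pts i)| <= B) ->
  `|Defs.lagrange f pts r y| <= r%:R * (B * r%:R ^+ r).
Proof.
move=> r0 h0 hy hp hf.
rewrite /Defs.lagrange (le_trans (ler_norm_sum _ _ _))//.
rewrite (_ : r%:R * _ = \sum_(1 <= i < r.+1) (B * r%:R ^+ r)); last first.
  by rewrite sumr_const_nat subn1 /= mulr_natl.
rewrite big_nat_cond [leRHS]big_nat_cond; apply: ler_sum => i.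
rewrite andbT ltnS => ir; rewrite normrM ler_pM// ?hf//.
rewrite normr_prod (_ : r%:R ^+ r = \prod_(1 <= j < r.+1) (r%:R : R)); last first.
  by rewrite prodr_const_nat subn1.
rewrite [leLHS]big_mkcond big_nat_cond [leRHS]big_nat_cond; apply: ler_prod => j.
rewrite andbT ltnS => jr; case: ifPn => [ji|_]; last by rewrite ler01/= ler1n.
rewrite normr_ge0/= normf_div ler_pdivrMr; last exact: lt_le_trans (hp i j _ _ _).
by rewrite (le_trans (hy j jr))// ler_wpM2l// hp.
Qed.

(** As [n >= r + 1], the nodes satisfy [i / n >= 1 / n] and [1 - i / n >= 1 / (r + 1)], so the
    weight there is at least the denominator in the bound. *)
Lemma Lint_le (R : realType) (r n : nat) (alpha beta M y : R) (f : R -> R) :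
  (2 <= r < n)%N -> 0 < alpha -> 0 < beta ->
  (forall y, 0 < y < 1 -> `|jweight alpha beta y * f y| <= M) ->
  0 <= y <= 2 / n%:R ->
  `|Lint r n f y| <=
    r%:R * (M / (n%:R^-1 `^ alpha * r.+1%:R^-1 `^ beta) * r%:R ^+ r).
Proof.
move=> /andP[r2 rn] al0 be0 hf /andP[y0 y2].
have n0 : 0 < n%:R :> R by rewrite ltr0n; lia.
set h : R := n%:R^-1; set q : R := r.+1%:R^-1.
have h0 : 0 < h by rewrite invr_gt0.
have q0 : 0 < q by rewrite invr_gt0.
have hq : h <= q by rewrite lef_pV2 ?posrE// ler_nat.
have rq : r%:R * q = 1 - q.
  by rewrite /q -[r%:R](addrK 1) natr1 mulrBl divff ?mul1r// pnatr_eq0.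
have lehM (i j : nat) : (i <= j)%N -> i%:R * h <= j%:R * h.
  by move=> ij; rewrite ler_wpM2r ?ler_nat// ltW.
apply: (@lagrange_le _ _ _ _ h _ _); [lia|by []| | |].
- move=> j /andP[/lehM j1 /lehM jr]; move/lehM: r2 => r2.
  by rewrite ler_norml; apply/andP; split; rewrite -/h in y2 *; lra.
- move=> i j _ _; case: (ltngtP j i) => // /lehM; rewrite -natr1 => ij _.
    by rewrite -/h ger0_norm; lra.
  by rewrite -/h ler0_norm; lra.
move=> i /andP[i1 ir]; rewrite -/h.
have ih : h <= i%:R * h by have := lehM _ _ i1; rewrite mul1r.
have iq : i%:R * h <= 1 - q.
  by rewrite -rq ler_pM// ?ler_nat// ltW.
have hi : 0 < i%:R * h < 1 by apply/andP; split; lra.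
rewrite ler_pdivlMr ?mulr_gt0 ?powR_gt0//.
apply: le_trans (hf _ hi); rewrite normrM mulrC ler_wpM2r//.
rewrite ger0_norm ?mulr_ge0 ?powR_ge0//.
by rewrite ler_pM ?powR_ge0// ge0_ler_powR ?nnegrE; lra.
Qed.

(** Lets the right endpoint follow from the left one, with [alpha] and [beta] exchanged. *)
Lemma Rint_reflect (R : realType) (r n : nat) (f : R -> R) (y : R) :
  Defs.Rint r n f y = Lint r n (fun t => f (1 - t)) (1 - y).
Proof.
apply: eq_bigr => i _; congr (_ * _); apply: eq_bigr => j _.
by rewrite -[RHS]mulrNN -invrN; congr (_ / _); ring.
Qed.

Lemma jweight_reflect (R : realType) (alpha beta x : R) :
  jweight beta alpha (1 - x) = jweight alpha beta x.
Proof. by rewrite /jweight subKr mulrC. Qed.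

(** For the transition zones, where [Fmod] blends [f] with an interpolant. *)
Lemma convex_le (R : realType) (u v t : R) : 0 <= t <= 1 ->
  `|u + t * (v - u)| <= `|u| + `|v|.
Proof.
move=> /andP[t0 t1]; have -> : u + t * (v - u) = (1 - t) * u + t * v by ring.
rewrite (le_trans (ler_normD _ _))// !normrM (ger0_norm t0).
by rewrite (@ger0_norm _ (1 - t)) ?lerD ?ler_piMl//; lra.
Qed.

(** On [[0, 2/n]] the first maximum is at most [2/n], which cancels the [n^-alpha] in the
    denominator of [Lint_le]; the second is at most 1. Hence a constant free of [n]. *)
Lemma Lint_weighted_le (R : realType) (r n : nat) (alpha beta M y : R)
    (f : R -> R) :
  (2 <= r < n)%N -> (4 <= n)%N -> 0 < alpha -> 0 < beta -> 0 <= M ->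
  (forall y, 0 < y < 1 -> `|jweight alpha beta y * f y| <= M) ->
  0 <= y <= 2 / n%:R ->
  `|Lint r n f y| *
    (Num.max y n%:R^-1 `^ alpha * Num.max (1 - y) n%:R^-1 `^ beta) <=
  r%:R ^+ r.+1 * 2 `^ alpha / r.+1%:R^-1 `^ beta * M.
Proof.
move=> rn n4 al0 be0 M0 hf hy; have /andP[y0 y2] := hy.
have hL := Lint_le rn al0 be0 hf hy.
have n0 : 0 < n%:R :> R by rewrite ltr0n; lia.
have hn : n%:R^-1 <= 4^-1 :> R by rewrite lef_pV2 ?posrE// ler_nat.
move: hn y2 hL; set h : R := n%:R^-1; set q : R := r.+1%:R^-1 => hn y2 hL.
have h0 : 0 < h by rewrite invr_gt0.
have q0 : 0 < q by rewrite invr_gt0.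
have hU : 0 <= Num.max y h <= 2 * h by rewrite le_max y0/= ge_max; lra.
have hV : 0 <= Num.max (1 - y) h <= 1 by rewrite le_max ge_max; lra.
have Ule : Num.max y h `^ alpha <= 2 `^ alpha * h `^ alpha.
  by rewrite -powRM//; [case/andP: hU => *; rewrite ge0_ler_powR ?nnegrE//; lra|lra].
have Vle : Num.max (1 - y) h `^ beta <= 1.
  case/andP: hV => V0 V1.
  by rewrite (le_trans (ge0_ler_powR (ltW be0) _ _ V1)) ?nnegrE// powR1.
apply: le_trans (ler_pM (normr_ge0 _) _ hL (ler_pM _ _ Ule Vle)) _;
  rewrite ?mulr_ge0 ?powR_ge0//.
have ha : h `^ alpha != 0 by rewrite gt_eqF// powR_gt0.
have hb : q `^ beta != 0 by rewrite gt_eqF// powR_gt0.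
by rewrite exprS le_eqVlt; apply/orP; left; apply/eqP; field; rewrite ha hb.
Qed.

Lemma Rint_weighted_le (R : realType) (r n : nat) (alpha beta M y : R)
    (f : R -> R) :
  (2 <= r < n)%N -> (4 <= n)%N -> 0 < alpha -> 0 < beta -> 0 <= M ->
  (forall y, 0 < y < 1 -> `|jweight alpha beta y * f y| <= M) ->
  1 - 2 / n%:R <= y <= 1 ->
  `|Defs.Rint r n f y| *
    (Num.max y n%:R^-1 `^ alpha * Num.max (1 - y) n%:R^-1 `^ beta) <=
  r%:R ^+ r.+1 * 2 `^ beta / r.+1%:R^-1 `^ alpha * M.
Proof.
move=> rn n4 al0 be0 M0 hf hy; rewrite Rint_reflect [X in _ * X]mulrC.
have := @Lint_weighted_le _ r n beta alpha M (1 - y) (fun t => f (1 - t)).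
rewrite subKr; apply => //.
  move=> z hz; have := hf (1 - z); rewrite -jweight_reflect subKr; apply; lra.
lra.
Qed.

Lemma Fmod_weighted_le (R : realType) (r : nat) (alpha beta : R) (psi : R -> R) :
  (2 <= r)%N -> 0 < alpha -> 0 < beta -> (forall t, 0 <= psi t <= 1) ->
  exists2 C : R, 0 < C &
    forall (n : nat) (f : R -> R) (M y : R), (4 <= n)%N -> (r < n)%N -> 0 <= M ->
      (forall y, 0 < y < 1 -> `|jweight alpha beta y * f y| <= M) ->
      0 <= y <= 1 ->
      `|Fmod psi r n f y| *
        (Num.max y n%:R^-1 `^ alpha * Num.max (1 - y) n%:R^-1 `^ beta) <= C * M.
Proof.
move=> r2 al0 be0 psi01.
set CL : R := r%:R ^+ r.+1 * 2 `^ alpha / r.+1%:R^-1 `^ beta.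
set CR : R := r%:R ^+ r.+1 * 2 `^ beta / r.+1%:R^-1 `^ alpha.
have CL0 : 0 <= CL by rewrite !mulr_ge0 ?invr_ge0 ?powR_ge0.
have CR0 : 0 <= CR by rewrite !mulr_ge0 ?invr_ge0 ?powR_ge0.
(* The summands pay for the left interpolant, the right interpolant and [f] itself. *)
exists (CL + CR + 1) => [|n f M y n4 rn M0 hf /andP[y0 y1]]; first by lra.
have rn2 : (2 <= r < n)%N by rewrite r2.
have hL := Lint_weighted_le (y := y) rn2 n4 al0 be0 M0 hf.
have hR := Rint_weighted_le (y := y) rn2 n4 al0 be0 M0 hf.
rewrite -/CL -/CR in hL hR.
have n0 : 0 < n%:R :> R by rewrite ltr0n; lia.
have hn : n%:R^-1 <= 4^-1 :> R by rewrite lef_pV2 ?posrE// ler_nat.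
have h0 : 0 < n%:R^-1 :> R by rewrite invr_gt0.
(* Between [1/n] and [1 - 1/n] the maxima are [y] and [1 - y], so the factor is the weight
   itself. *)
have hF : n%:R^-1 <= y <= 1 - n%:R^-1 -> `|f y| *
    (Num.max y n%:R^-1 `^ alpha * Num.max (1 - y) n%:R^-1 `^ beta) <= M.
  move=> /andP[hy hy1]; rewrite !max_l; [|lra|by []].
  have hy01 : 0 < y < 1 by apply/andP; split; lra.
  apply: le_trans (hf _ hy01); rewrite normrM [leRHS]mulrC ler_wpM2l//.
  by rewrite ger0_norm ?mulr_ge0 ?powR_ge0.
have W0 : 0 <= Num.max y n%:R^-1 `^ alpha * Num.max (1 - y) n%:R^-1 `^ beta.
  by rewrite mulr_ge0 ?powR_ge0.
move: (_ * _) W0 hL hR hF => W W0 hL hR hF; rewrite !mulrDl mul1r.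
have CLM := mulr_ge0 CL0 M0; have CRM := mulr_ge0 CR0 M0.
rewrite /Fmod div1r; case: ifPn => [y1n|]; first by have := hL; lra.
rewrite -ltNge => yn1; case: ifPn => [y2n|].
  (* Since [n >= 4], [2/n <= 1 - 1/n], so [hF] applies on this zone. *)
  rewrite (le_trans (ler_wpM2r W0 (convex_le _ _ (psi01 _))))// mulrDl.
  have := hL; have := hF; lra.
rewrite -ltNge => yn2; case: ifPn => [y3n|].
  by have := hF; lra.
rewrite -leNgt => yn3; case: ifPn => [y4n|].
  rewrite (le_trans (ler_wpM2r W0 (convex_le _ _ (psi01 _))))// mulrDl.
  have := hR; have := hF; lra.
by rewrite -leNgt => yn4; have := hR; lra.
Qed.

(** * Weighted bounds for differences of nodal values *)

(* Averaging the two lower bounds, [U >= (k + 1) / (2 (N + r))], so that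
   [x / U <= 2 (r + 1) ((N + 1) x / (k + 1))]. *)
Lemma powR_node_le (R : realType) (N r k a : nat) (alpha x U : R) :
  0 < alpha <= a%:R -> 0 <= x ->
  k%:R / (N + r)%:R <= U -> 0 < (N + r)%:R^-1 :> R -> (N + r)%:R^-1 <= U ->
  x `^ alpha <=
    U `^ alpha * ((2 * r.+1)%:R ^+ a * (1 + (N.+1%:R * x / k.+1%:R) ^+ a)).
Proof.
move=> /andP[al0 ala] x0 kU m0 mU.
have U0 : 0 < U by apply: lt_le_trans mU.
set s := N.+1%:R * x / k.+1%:R.
have s0 : 0 <= s by rewrite !mulr_ge0 ?invr_ge0.
set D : R := (2 * r.+1)%:R.
have D1 : 1 <= D by rewrite ler1n.
have xU : x <= U * (D * s).
  have mN0 : (N + r)%:R != 0 :> R by rewrite -invr_eq0 gt_eqF.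
  have k0 : k.+1%:R != 0 :> R by rewrite pnatr_eq0.
  have kU' : k.+1%:R / (2 * (N + r)%:R) <= U.
    rewrite invfM mulrCA -[k.+1%:R]natr1 mulrDl mul1r; lra.
  apply: le_trans (ler_wpM2r _ kU'); last by rewrite mulr_ge0// (le_trans ler01).
  have -> : k.+1%:R / (2 * (N + r)%:R) * (D * s) =
      D * N.+1%:R / (2 * (N + r)%:R) * x.
    by rewrite /s; move: k0 mN0 => /=; set k' := k.+1%:R; set m := (N + r)%:R;
      set D' := N.+1%:R; move: k' m D D' {D1} => k' m D D' *; field; apply/andP.
  (* This reduces to [N + r <= r.+1 * N.+1], the source of the factor [r.+1] in [D]. *)
  rewrite ler_peMl// ler_pdivlMr ?mul1r; last by rewrite mulr_gt0// -invr_gt0.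
  by rewrite /D -!natrM ler_nat; clear; nia.
have xU' : x `^ alpha <= (U * (D * s)) `^ alpha.
  by rewrite (ge0_ler_powR (ltW al0) _ _ xU) ?nnegrE// (le_trans x0).
have Ds0 : 0 <= D * s by rewrite mulr_ge0// (le_trans ler01).
apply: le_trans xU' _; rewrite (powRM _ (ltW U0) Ds0) ler_wpM2l ?powR_ge0//.
have hal : 0 <= alpha <= a%:R by rewrite ltW.
rewrite (le_trans (powR_le1DX Ds0 hal))//.
by rewrite exprMn mulrDr mulr1 lerD2r exprn_ege1.
Qed.

Lemma horner_bernpoly (R : realType) (g : nat -> R) (N : nat) (x : R) :
  (bernpoly g N).[x] =
  \sum_(k < N.+1) g k * ('C(N, k)%:R * (x ^+ k * (1 - x) ^+ (N - k))).
Proof.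
rewrite /bernpoly horner_sum; apply: eq_bigr => k _.
by rewrite hornerZ hornerM !horner_exp hornerD hornerN hornerX hornerC mulrA.
Qed.

(** Expanding the product gives [bernstein_sum_le] with exponents [(0, 0)], [(a, 0)], [(0, b)] and
    [(a, b)], whose bounds add up to the right-hand side. *)
Lemma bernstein_sumD_le (R : realType) (N a b : nat) (x : R) : 0 <= x <= 1 ->
  \sum_(k < N.+1) (1 + (N.+1%:R * x / k.+1%:R) ^+ a) *
     (1 + (N.+1%:R * (1 - x) / (N - k).+1%:R) ^+ b) *
     ('C(N, k)%:R * (x ^+ k * (1 - x) ^+ (N - k))) <=
  (a`!.+1 * b`!.+1)%:R.
Proof.
move=> hx.
have -> : (a`!.+1 * b`!.+1)%:R =
    (0`! * 0`!)%:R + (a`! * 0`!)%:R + (0`! * b`!)%:R + (a`! * b`!)%:R :> R.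
  by rewrite -!natrD; congr _%:R; rewrite !fact0; nia.
have h u v := @bernstein_sum_le _ N u v _ hx.
apply: le_trans (lerD (lerD (lerD (h 0 0) (h a 0)) (h 0 b)) (h a b)).
rewrite -!big_split /=; apply: ler_sum => k _.
by rewrite !expr0 le_eqVlt; apply/orP; left; apply/eqP; ring.
Qed.

(** The cut-off [h], later [1/n], is kept apart from the mesh [1/(N + r)] because the combination
    has degrees [n_i >= n]. *)
Lemma bernpoly_fdiff_weighted_le (R : realType) (N r a b : nat)
    (alpha beta x h B : R) (g : nat -> R) :
  0 < alpha <= a%:R -> 0 < beta <= b%:R -> 0 <= x <= 1 ->
  0 < (N + r)%:R^-1 :> R -> (N + r)%:R^-1 <= h ->
  (forall k, (k <= N + r)%N ->
     `|g k| * (Num.max (k%:R / (N + r)%:R) h `^ alpha *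
               Num.max (1 - k%:R / (N + r)%:R) h `^ beta) <= B) ->
  `|jweight alpha beta x * (bernpoly (iter r (@fdiff R) g) N).[x]| <=
  2 ^+ r * B * (2 * r.+1)%:R ^+ (a + b) * (a`!.+1 * b`!.+1)%:R.
Proof.
move=> hal hbe hx m0 mh hg; have /andP[x0 x1] := hx.
have y0 : 0 <= 1 - x by rewrite subr_ge0.
set D : R := (2 * r.+1)%:R; set m : R := (N + r)%:R in m0 mh hg *.
have B0 : 0 <= B.
  apply: le_trans (hg 0%N _) => //.
  by rewrite mulr_ge0 ?mulr_ge0 ?powR_ge0.
have w0 : 0 <= jweight alpha beta x by rewrite mulr_ge0 ?powR_ge0.
have m_ge0 : 0 < m by rewrite -invr_gt0.
have D0 : 0 <= D by [].
pose s k := 1 + (N.+1%:R * x / k.+1%:R) ^+ a.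
pose t k := 1 + (N.+1%:R * (1 - x) / (N - k).+1%:R) ^+ b.
have s0 k : 0 <= s k.
  by rewrite addr_ge0 ?exprn_ge0// !mulr_ge0 ?invr_ge0.
have t0 k : 0 <= t k.
  by rewrite addr_ge0 ?exprn_ge0// !mulr_ge0 ?invr_ge0.
(* The bound depends on [k] but not on [j], as [fdiff_iter_le] requires for the whole block of
   [r + 1] nodes. *)
have wg k j : (k <= N)%N -> (j <= r)%N ->
    jweight alpha beta x * `|g (k + j)%N| <= B * D ^+ (a + b) * (s k * t k).
  move=> kN jr; have kjN : (k + j <= N + r)%N by rewrite leq_add.
  have := hg _ kjN.
  set U := Num.max _ _; set V := Num.max (1 - _) _ => hUV.
  have hU : x `^ alpha <= U `^ alpha * (D ^+ a * s k).
    apply: powR_node_le => //; last by rewrite le_max mh orbT.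
    by rewrite le_max ler_pM2r ?invr_gt0// ler_nat leq_addr.
  have hV : (1 - x) `^ beta <= V `^ beta * (D ^+ b * t k).
    apply: powR_node_le => //; last by rewrite le_max mh orbT.
    (* With 1 written as [m / m]: since [j <= r], the node [(k + j) / m] is at distance at least
       [(N - k) / m] from 1. *)
    rewrite le_max -[X in X - _](@divff _ m) ?gt_eqF// -mulrBl.
    apply/orP; left; rewrite (ler_pM2r m0) lerBrDr -natrD ler_nat.
    by rewrite addnA subnK// leq_add2l.
  rewrite /jweight; apply: le_trans (ler_wpM2r (normr_ge0 _)
    (ler_pM (powR_ge0 _ _) (powR_ge0 _ _) hU hV)) _.
  rewrite exprD.
  have -> : U `^ alpha * (D ^+ a * s k) * (V `^ beta * (D ^+ b * t k)) *
      `|g (k + j)%N| = `|g (k + j)%N| * (U `^ alpha * V `^ beta) *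
      (D ^+ a * D ^+ b * (s k * t k)) by ring.
  by rewrite -[leRHS]mulrA ler_wpM2r// !mulr_ge0// exprn_ge0.
rewrite normrM (ger0_norm w0) horner_bernpoly.
apply: le_trans (ler_wpM2l w0 (ler_norm_sum _ _ _)) _; rewrite mulr_sumr.
apply: (@le_trans _ _ (\sum_(k < N.+1) 2 ^+ r * B * D ^+ (a + b) *
    (s k * t k * ('C(N, k)%:R * (x ^+ k * (1 - x) ^+ (N - k)))))).
  apply: ler_sum => k _.
  have p0 : 0 <= 'C(N, k)%:R * (x ^+ k * (1 - x) ^+ (N - k)).
    by rewrite !mulr_ge0// exprn_ge0.
  rewrite normrM (ger0_norm p0) !mulrA -!mulrA mulrA [leRHS]mulrA.
  have kN : (k <= N)%N by rewrite -ltnS.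
  have := fdiff_iter_le w0 (fun j => @wg k j kN).
  by rewrite !mulrA => /(ler_wpM2r p0); rewrite !mulrA.
rewrite -mulr_sumr ler_wpM2l//; last exact: bernstein_sumD_le.
by rewrite !mulr_ge0 ?exprn_ge0.
Qed.

(** * Summation over the combination *)

Theorem theorem1 (R : realType) (r : nat) (alpha beta : R)
  (psi : R -> R) (nn : nat -> nat -> nat) (c : nat -> nat -> R) (K : R) :
  (2 <= r)%N -> 0 < alpha -> 0 < beta ->
  smooth psi -> (forall t, 0 <= psi t <= 1) ->
  (forall t, t <= 0 -> psi t = 0) -> (forall t, 1 <= t -> psi t = 1) ->
  admissible_comb nn c r K ->
  exists C : R, 0 < C /\
    forall (n : nat) (f : R -> R), (4 <= n)%N -> (r < n)%N ->
      in_Cw alpha beta f ->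
      forall M : R,
        (forall y, 0 < y < 1 -> `|jweight alpha beta y * f y| <= M) ->
        forall x, 0 <= x <= 1 ->
          `|jweight alpha beta x * (derivn r (bstar psi nn c r n f)).[x]|
            <= C * n%:R ^+ r * M.
Proof.
move=> r2 al0 be0 _ psi01 _ _ hcomb.
have [C1 C10 hF] := Fmod_weighted_le r2 al0 be0 psi01.
have natub (e : R) : 0 < e -> exists a : nat, 0 < e <= a%:R.
  by move=> e0; exists (Num.bound e); rewrite e0 ltW// archi_boundP// ltW.
have [a ha] := natub _ al0; have [b hb] := natub _ be0.
have nn_le n i : (0 < n)%N -> (i < r.-1)%N -> (n <= nn n i <= nn n (r - 2))%N.
  move=> n0 ir; have [n_0 nS _ _ _] := hcomb n n0.
  have mono j k : (j + k < r.-1)%N -> (nn n j <= nn n (j + k))%N.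
    elim: k => [|k IH] jk; first by rewrite addn0.
    rewrite addnS in jk *; exact: leq_trans (IH (ltnW jk)) (ltnW (nS _ jk)).
  have ei : (i + (r - 2 - i) = r - 2)%N by lia.
  have := mono 0%N i ir; rewrite n_0 => ->.
  by have := mono i (r - 2 - i)%N; rewrite ei; apply; lia.
(* At [n = 1] the degree conditions give [1 <= n_(r-2) <= K]. *)
have K0 : 0 < K.
  have [nn0 _ [nnK _] _ _] := hcomb 1%N isT.
  have /andP[+ _] := nn_le 1%N (r - 2)%N isT ltac:(lia).
  by rewrite mulr1 in nnK; rewrite -(ler_nat R); lra.
set S : R := 2 ^+ r * C1 * (2 * r.+1)%:R ^+ (a + b) * (a`!.+1 * b`!.+1)%:R.
have S0 : 0 < S by rewrite !mulr_gt0 ?exprn_gt0// ltr0n muln_gt0.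
(* One [K] bounds the sum of the [|c n i|], [K ^+ r] comes from the degrees being at most [K n], and
   [S] from the weighted difference bound. *)
exists (K * (K ^+ r * S)); split; first by rewrite !mulr_gt0 ?exprn_gt0.
move=> n f n4 rn _ M hM x hx.
have n0 : (0 < n)%N by lia.
have M0 : 0 <= M by apply: le_trans (hM 2^-1 _) => //; lra.
have [_ _ [nnK cK] _ _] := hcomb n n0.
rewrite /bstar /bcomb raddf_sum /= horner_sum mulr_sumr.
apply: le_trans (ler_norm_sum _ _ _) _.
have -> : K * (K ^+ r * S) * n%:R ^+ r * M = K * (K ^+ r * n%:R ^+ r * (S * M)) by ring.
have T0 : 0 <= K ^+ r * n%:R ^+ r * (S * M).
  by rewrite !mulr_ge0 ?exprn_ge0// ltW.
apply: le_trans (ler_wpM2r T0 cK); rewrite mulr_suml; apply: ler_sum => i _.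
rewrite derivnZ hornerZ mulrCA normrM ler_wpM2l//.
have /andP[ni iK] := nn_le n i n0 (ltn_ord i).
move: (nn n i) ni iK => m ni iK.
(* Here [m >= n > r], so the formula for the [r]-th derivative applies. *)
have [N mE] : exists N, m = (N + r)%N.
  by exists (m - r)%N; rewrite subnK// (leq_trans (ltnW rn)).
rewrite -[bernstein _ _]/(bernpoly (fun k => Fmod psi r n f (k%:R / m%:R)) m) mE.
rewrite derivn_bernpoly hornerZ mulrCA normrM ger0_norm//.
have m0 : 0 < (N + r)%:R :> R by rewrite ltr0n -mE (leq_trans n0).
apply: ler_pM => //.
  (* Each of the [r] factors of the falling factorial is at most the degree, which is at most
     [K n]. *)
  rewrite -exprMn (@le_trans _ _ ((N + r)%:R ^+ r))//.
    by rewrite -natrX ler_nat ffact_prod -[X in (_ <= _ ^ X)%N]card_ord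
      -prod_nat_const; apply: leq_prod => j _; rewrite leq_subr.
  rewrite lerXn2r ?nnegrE ?mulr_ge0 ?(ltW K0)//.
  by rewrite (le_trans _ nnK)// ler_nat -mE.
have -> : S * M =
    2 ^+ r * (C1 * M) * (2 * r.+1)%:R ^+ (a + b) * (a`!.+1 * b`!.+1)%:R.
  by rewrite /S; ring.
apply: (@bernpoly_fdiff_weighted_le _ _ _ _ _ _ _ _ n%:R^-1) => //.
  by rewrite invr_gt0.
  by rewrite -mE lef_pV2 ?posrE ?ltr0n ?ler_nat// (leq_trans n0).
move=> k km; apply: hF => //.
by rewrite divr_ge0//= ler_pdivrMr// mul1r ler_nat.
Qed.
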